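(* Let $x_0=0$ (so that $x_{n,k^0}=0$). Let $\underline{\widehat r}=(\widehat r_1,\dots,\widehat r_{n_0})\in\mathcal C^0_n$ and let $\widehat r$ be its piecewise linear interpolation on $[x_{n,1},x_{n,n_0}]$ (so $\widehat r(x_{n,i})=\widehat r_i$). Define $$R^L_k:=\sum_{j=1}^k \widehat r_j,\qquad S^L_k:=\sum_{j=1}^k Y_{n,j},\qquad k=1,\dots,k^0-1,$$ $$R^R_k:=\sum_{j=k}^{n_0}\widehat r_j,\qquad S^R_k:=\sum_{j=k}^{n_0}Y_{n,j},\qquad k=k^0+1,\dots,n_0.$$ Then $\underline{\widehat r}$ is the unique minimizer of $\phi_n$ over $\mathcal C^0_n$ if and only if all of the following hold: (i) $\displaystyle\sum_{k=1}^{j-1}R^L_k\,(x_{n,k+1}-x_{n,k})\le \sum_{k=1}^{j-1}S^L_k\,(x_{n,k+1}-x_{n,k})$ for all $2\le j\le k^0$, with equality whenever $x_{n,j}$ is a knot of $\widehat r$; (ii) $\displaystyle\sum_{k=j+1}^{n_0}R^R_k\,(x_{n,k}-x_{n,k-1})\le \sum_{k=j+1}^{n_0}S^R_k\,(x_{n,k}-x_{n,k-1})$ for all $k^0+1\le j\le n_0-1$, with equality whenever $x_{n,j}$ is a knot of $\widehat r$; (iii) $\displaystyle\sum_{k=1}^{k^0-1}(R^L_k-S^L_k)(x_{n,k+1}-x_{n,k})=\sum_{k=k^0+1}^{n_0}(R^R_k-S^R_k)(x_{n,k}-x_{n,k-1})$.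
   Context: Original data: fixed real points $\tilde x_{n,1}<\dots<\tilde x_{n,n}$ and responses $\tilde Y_{n,i}=\tilde r_0(\tilde x_{n,i})+\epsilon_{n,i}$, where $\tilde r_0:\mathbb R\to\mathbb R$ is concave, with $\tilde r_0(x_0)=y_0$ for a fixed $(x_0,y_0)\in\mathbb R^2$, and the $\epsilon_{n,i}$ are i.i.d. with mean $0$ and $Ee^{t\epsilon_{n,i}^2}<\infty$ for some $t>0$. Augmented data $(x_{n,i},Y_{n,i})_{i=1}^{n_0}$: - If $x_0=\tilde x_{n,k^0}$ for some $1\le k^0\le n$, put $n_0:=n$, $x_{n,i}:=\tilde x_{n,i}$ and $Y_{n,i}:=\tilde Y_{n,i}-y_0-\tilde r_0'(x_0)(\tilde x_{n,i}-x_0)$. - Otherwise let $1\le k^0\le n+1$ satisfy $\tilde x_{n,k^0-1}<x_0<\tilde x_{n,k^0}$ (with $\tilde x_{n,0}=-\infty$, $\tilde x_{n,n+1}=\infty$). Put $n_0:=n+1$; for $i<k^0$, $x_{n,i}:=\tilde x_{n,i}$ and $Y_{n,i}:=\tilde Y_{n,i}-y_0-\tilde r_0'(x_0)(\tilde x_{n,i}-x_0)$; $x_{n,k^0}:=x_0$ and $Y_{n,k^0}:=0$; for $k^0<i\le n_0$, $x_{n,i}:=\tilde x_{n,i-1}$ and $Y_{n,i}:=\tilde Y_{n,i-1}-y_0-\tilde r_0'(x_0)(\tilde x_{n,i-1}-x_0)$. Let $I\subset\{1,\dots,n_0\}$ be the set of the $n$ indices corresponding to actual data points (so $I=\{1,\dots,n_0\}$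 if $n_0=n$, and $I=\{1,\dots,n_0\}\setminus\{k^0\}$ if $n_0=n+1$). $\mathcal C$ is the set of concave, closed (upper semicontinuous), proper functions $\mathbb R\to[-\infty,\infty)$, and $\mathcal C^0:=\{r\in\mathcal C: r(x_0)=0\}$. The set $\mathcal C^0_n\subset\mathbb R^{n_0}$ consists of all (real) vectors $(r(x_{n,1}),\dots,r(x_{n,n_0}))$ with $r\in\mathcal C^0$. For $r=(r_1,\dots,r_{n_0})\in\mathbb R^{n_0}$, $\phi_n(r):=\frac12\sum_{i\in I}(Y_{n,i}-r_i)^2$. A knot of a piecewise linear function with possible bends at the $x_{n,j}$ is an interior point $x_{n,j}$ ($1<j<n_0$) at which its slope changes. Empty sums are $0$. *)

(* Defs.v *)
From HB Require Import structures.
From mathcomp Require Import all_boot all_order all_algebra.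
From mathcomp Require Import all_classical all_reals all_analysis.

Set Implicit Arguments.
Unset Strict Implicit.
Unset Printing Implicit Defensive.

Import Order.TTheory GRing.Theory Num.Theory.
Import numFieldNormedType.Exports.

Local Open Scope classical_set_scope.
Local Open Scope ring_scope.

(* A finite family a_1, ..., a_m is a function [a] on [nat], of which only the
   values at 1 <= i <= m matter. *)

Definition increasing_design (R : realType) (n : nat) (xt : nat -> R) : Prop :=
  forall i j, (1 <= i)%N -> (i < j)%N -> (j <= n)%N -> xt i < xt j.

Section Errors.
Context d (T : measurableType d) (R : realType) (P : probability T R).

(* The sets [B i] may be [setT], so the product rule over all of 1, ..., n
   contains the product rule over each subfamily. *)
Definition mutually_independent (n : nat) (eps : nat -> {RV P >-> R}) : Prop :=
  forall B : nat -> set R, (forall i, measurable (B i)) ->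
    (P (\bigcap_(i in [set i | (1 <= i <= n)%N]) (eps i @^-1` B i)) =
     \prod_(1 <= i < n.+1) P (eps i @^-1` B i))%E.

Definition identically_distributed (n : nat) (eps : nat -> {RV P >-> R}) : Prop :=
  forall i j, (1 <= i <= n)%N -> (1 <= j <= n)%N ->
  forall B : set R, measurable B ->
    distribution P (eps i) B = distribution P (eps j) B.

Definition centered (n : nat) (eps : nat -> {RV P >-> R}) : Prop :=
  forall i, (1 <= i <= n)%N -> 'E_P[eps i]%E = 0%:E.

Definition exp_square_moment (n : nat) (eps : nat -> {RV P >-> R}) : Prop :=
  exists2 t : R, 0 < t &
    forall i, (1 <= i <= n)%N ->
      ('E_P[fun w => expR (t * (eps i w) ^+ 2)] < +oo)%E.

End Errors.

Section Augmentation.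
Context (R : realType) (n : nat) (xt : nat -> R) (x0 : R).

Definition in_design : bool := x0 \in [seq xt i | i <- iota 1 n].

Definition aug_size : nat := if in_design then n else n.+1.

(* The guards encode the conventions xt 0 = -oo and xt n.+1 = +oo. *)
Definition is_anchor (k0 : nat) : Prop :=
  if in_design then (1 <= k0 <= n)%N /\ xt k0 = x0
  else [/\ (1 <= k0 <= n.+1)%N,
           (1 < k0)%N -> xt k0.-1 < x0
         & (k0 <= n)%N -> x0 < xt k0].

Context (k0 : nat).

Definition aug_points (i : nat) : R :=
  if in_design then xt i
  else if (i < k0)%N then xt i
  else if i == k0 then x0
  else xt i.-1.

(* [slope] stands for the derivative at [x0] of the true regression function. *)
Definition aug_responses (Yt : nat -> R) (y0 slope : R) (i : nat) : R :=
  let Yc j := Yt j - y0 - slope * (xt j - x0) in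
  if in_design then Yc i
  else if (i < k0)%N then Yc i
  else if i == k0 then 0
  else Yc i.-1.

(* Membership in I of an index between 1 and [aug_size]. *)
Definition observed (i : nat) : bool := in_design || (i != k0).

End Augmentation.

Section ConcaveFunctions.
Context (R : realType).
Implicit Types (r : R -> \bar R).

(* As r < +oo, the right-hand sum is never of the form (-oo) + (+oo). *)
Definition econcave r : Prop :=
  forall (a b t : R), 0 <= t <= 1 ->
    (t%:E * r a + (1 - t)%:E * r b <= r (t * a + (1 - t) * b)%R)%E.

Definition closed_proper_concave : set (R -> \bar R) :=
  [set r | [/\ forall a, (r a < +oo)%E,
               exists a, (-oo < r a)%E,
               econcave r
             & lower_semicontinuous (fun a => - r a)%E]].

Definition anchored_concave (x0 : R) : set (R -> \bar R) :=
  [set r | closed_proper_concave r /\ r x0 = 0%:E].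

(* Entry [v 0 j] is the coordinate of the index j.+1. *)
Definition anchored_vectors (m : nat) (x : nat -> R) (x0 : R) : set 'rV[R]_m :=
  [set v | exists2 r, anchored_concave x0 r &
             forall j : 'I_m, r (x j.+1) = (v ord0 j)%:E].

End ConcaveFunctions.

(* The coordinate of index i for 1 <= i <= m. *)
Definition coord1 (R : realType) (m : nat) (v : 'rV[R]_m) (i : nat) : R :=
  if insub i.-1 is Some j then v ord0 j else 0.

Definition least_squares (R : realType) (m : nat) (obs : nat -> bool)
    (Y : nat -> R) (v : 'rV[R]_m) : R :=
  2^-1 * \sum_(1 <= i < m.+1 | obs i) (Y i - coord1 v i) ^+ 2.

Definition unique_minimizer (R : realType) (E : Type) (f : E -> R) (C : set E)
    (v : E) : Prop :=
  [/\ C v, forall w, C w -> f v <= f w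
    & forall u, C u -> (forall w, C w -> f u <= f w) -> u = v].

Section PiecewiseLinear.
Context (R : realType) (m : nat) (x : nat -> R).

Definition chord_slope (f : R -> R) (a b : R) : R := (f b - f a) / (b - a).

Definition linear_interpolation (a : nat -> R) (f : R -> R) : Prop :=
  (forall i, (1 <= i <= m)%N -> f (x i) = a i) /\
  (forall k, (1 <= k < m)%N -> forall s, x k <= s <= x k.+1 ->
     f s = f (x k) + chord_slope f (x k) (x k.+1) * (s - x k)).

Definition knot (f : R -> R) (j : nat) : Prop :=
  (1 < j < m)%N /\
  chord_slope f (x j.-1) (x j) <> chord_slope f (x j) (x j.+1).

End PiecewiseLinear.

Definition sum_upto (R : realType) (a : nat -> R) (k : nat) : R :=
  \sum_(1 <= j < k.+1) a j.

Definition sum_from (R : realType) (m : nat) (a : nat -> R) (k : nat) : R :=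
  \sum_(k <= j < m.+1) a j.

(* Main.v *)
Require Import Defs.
From HB Require Import structures.
From mathcomp Require Import all_boot all_order all_algebra.
From mathcomp Require Import all_classical all_reals all_analysis.
From mathcomp Require Import zify ring lra.

Set Implicit Arguments.
Unset Strict Implicit.
Unset Printing Implicit Defensive.

Import Order.TTheory GRing.Theory Num.Theory.
Import numFieldNormedType.Exports.

Local Open Scope classical_set_scope.
Local Open Scope ring_scope.

(** A vector lies in the feasible set exactly when its k0-th entry vanishes and
    its slopes decrease along the design, that is, when all its kinks
    (slope before minus slope after) are nonnegative
    ([anchored_vectorsP]).  The feasible set is therefore convex, and since the
    entry at the anchor is pinned to 0, the least squares functional is a
    strictly convex quadratic on it.  So a feasible vector a is its unique
    minimizer if and only if the variational inequality
    sum_i (a_i - Y_i) (b_i - a_i) >= 0 holds for all feasible b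
    ([unique_minimizer_variational]); the sum may run over all indices, because
    the term of the anchor is 0.

    Write d = a - Y.  The sums in the theorem are the moments of d against the
    hinge functions bending at a design point:
    L_j = sum_(i < j) d_i (x_j - x_i) on the left of the anchor and
    R_j = sum_(i > j) d_i (x_i - x_j) on the right.  Two summations by parts
    turn the pairing of d with any b vanishing at the anchor into
    (R_k0 - L_k0) s_k0 - sum_(1 < j <= k0) L_j kink_j - sum_(k0 < j < N) R_j kink_j
    ([pairing_kinks]), where s_k0 is the slope of b to the right of the anchor.

    The equivalence of the variational inequality with the three conditions
    ([variational_moments]) is then a matter of reading signs.  Starting
    from a, one may add the identity with either sign, which forces
    L_k0 = R_k0, or subtract a hinge, which forces L_j <= 0 and R_j <= 0; at a
    knot of a one may also add the hinge scaled by the kink of a, and this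
    forces equality.  Conversely the three conditions make each
    term of the expansion nonnegative for b and zero for a. *)

(** * Moments and kinks *)

Section SummationByParts.
Context (R : realType).
Implicit Types (x a d : nat -> R).

Lemma big_nat_eq0 (F : nat -> R) m n :
  (forall i, (m <= i < n)%N -> F i = 0) -> \sum_(m <= i < n) F i = 0.
Proof. by move=> F0; rewrite big_nat_cond big1// => i /andP[+ _]; exact: F0. Qed.

Lemma sum_by_parts_upto d a m : (1 <= m)%N ->
  \sum_(1 <= i < m) d i * a i =
  sum_upto d m.-1 * a m - \sum_(1 <= k < m) sum_upto d k * (a k.+1 - a k).
Proof.
rewrite /sum_upto; case: m => // m _ /=; elim: m => [|m IH].
  by rewrite !big_nil mul0r subr0.
by rewrite !(@big_nat_recr _ _ _ m.+1 1)//= IH; ring.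
Qed.

Lemma sum_by_parts_from N d a m : (m <= N)%N ->
  \sum_(m.+1 <= i < N.+1) d i * a i =
  sum_from N d m.+1 * a m
  + \sum_(m.+1 <= k < N.+1) sum_from N d k * (a k - a k.-1).
Proof.
rewrite /sum_from => mN; have [p Np] : exists p, (m + p)%N = N.
  by exists (N - m)%N; lia.
elim: p m {mN} Np => [|p IH] m Np.
  by rewrite -Np addn0 !big_geq// mul0r addr0.
rewrite !(@big_ltn _ _ _ m.+1 N.+1)/=; [|lia..].
by rewrite (IH m.+1) ?addSnnS//; ring.
Qed.

(** With [d] the fitted values or the responses, these are the two sides of the
    conditions of the theorem; [left_momentE] and [right_momentE] identify them
    as pairings with hinge functions. *)
Definition left_moment x d j : R :=
  \sum_(1 <= k < j) sum_upto d k * (x k.+1 - x k).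

Definition right_moment N x d j : R :=
  \sum_(j.+1 <= k < N.+1) sum_from N d k * (x k - x k.-1).

Lemma left_momentE x d j : (1 <= j)%N ->
  left_moment x d j = \sum_(1 <= i < j) d i * (x j - x i).
Proof.
move=> j1; rewrite (sum_by_parts_upto d (fun i => x j - x i))//.
rewrite subrr mulr0 add0r /left_moment -sumrN.
by apply: eq_bigr => k _; ring.
Qed.

Lemma right_momentE N x d j : (j <= N)%N ->
  right_moment N x d j = \sum_(j.+1 <= i < N.+1) d i * (x i - x j).
Proof.
move=> jN; rewrite (sum_by_parts_from d (fun i => x i - x j))//.
rewrite subrr mulr0 add0r /right_moment.
by apply: eq_bigr => k _; ring.
Qed.

Lemma left_momentB x d e j :
  left_moment x (fun i => d i - e i) j = left_moment x d j - left_moment x e j.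
Proof.
by rewrite /left_moment -sumrB; apply: eq_bigr => k _; rewrite /sum_upto sumrB; ring.
Qed.

Lemma right_momentB N x d e j :
  right_moment N x (fun i => d i - e i) j =
  right_moment N x d j - right_moment N x e j.
Proof.
by rewrite /right_moment -sumrB; apply: eq_bigr => k _; rewrite /sum_from sumrB; ring.
Qed.

Definition secant x a k : R := (a k.+1 - a k) / (x k.+1 - x k).

Definition kink x a j : R := secant x a j.-1 - secant x a j.

(** A second summation by parts: the partial sums of the products
    [sum_upto d k * (x k.+1 - x k)] are the left moments, and the increments of
    the secants are the kinks. *)
Lemma sum_left_kinks N x d a m :
  increasing_design N x -> (1 <= m <= N)%N -> a m = 0 ->
  \sum_(1 <= i < m) d i * a i =
  - (left_moment x d m * secant x a m)
  - \sum_(2 <= j < m.+1) left_moment x d j * kink x a j.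
Proof.
move=> xincr /andP[m1 mN] am; rewrite sum_by_parts_upto// am mulr0 add0r.
under eq_big_nat => k /andP[k1 km].
  have dx : x k.+1 - x k != 0 by rewrite subr_eq0 gt_eqF// xincr//; lia.
  rewrite (_ : _ * _ = (sum_upto d k * (x k.+1 - x k)) * secant x a k);
    last by rewrite /secant; field.
  over.
rewrite (sum_by_parts_upto _ (secant x a))// {1}/sum_upto prednK//.
rewrite opprB addrC -/(left_moment _ _ _); congr (_ + _).
rewrite big_add1 /= -sumrN; apply: eq_bigr => k _.
by rewrite /left_moment /sum_upto /kink /=; ring.
Qed.

Lemma sum_right_kinks N x d a m :
  increasing_design N x -> (1 <= m <= N)%N -> a m = 0 ->
  \sum_(m.+1 <= i < N.+1) d i * a i =
  right_moment N x d m * secant x a m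
  - \sum_(m.+1 <= j < N) right_moment N x d j * kink x a j.
Proof.
move=> xincr /andP[m1 mN] am; rewrite sum_by_parts_from// am mulr0 add0r.
under eq_big_nat => k /andP[km kN].
  have dx : x k - x k.-1 != 0 by rewrite subr_eq0 gt_eqF// xincr//; lia.
  rewrite (_ : _ * _ = (sum_from N d k * (x k - x k.-1)) * secant x a k.-1);
    last by rewrite /secant prednK; [field | lia].
  over.
rewrite (sum_by_parts_from _ (fun k => secant x a k.-1))// {1}/sum_from.
rewrite -/(right_moment _ _ _ _).
have [->|mltN] : m = N \/ (m < N)%N by lia.
  by rewrite [right_moment _ _ _ _]big_geq// !big_geq; [ring|lia..].
rewrite big_ltn//= {1}/sum_from -/(right_moment _ _ _ _) big_add1/=.
rewrite -[X in _ + (_ + X)]opprK -sumrN.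
rewrite (eq_bigr (fun j => right_moment N x d j * kink x a j)); first by ring.
by move=> j _; rewrite /right_moment /sum_from /kink; ring.
Qed.

(** The secant at [m] carries all that the linear part of [a] contributes.  For
    [m = N] it involves the values of [x] and [a] at [N.+1]; the terms with
    [secant x a N] then cancel. *)
Lemma pairing_kinks N x d a m :
  increasing_design N x -> (1 <= m <= N)%N -> a m = 0 ->
  \sum_(1 <= i < N.+1) d i * a i =
  (right_moment N x d m - left_moment x d m) * secant x a m
  - \sum_(2 <= j < m.+1) left_moment x d j * kink x a j
  - \sum_(m.+1 <= j < N) right_moment N x d j * kink x a j.
Proof.
move=> xincr mN am; rewrite (@big_cat_nat _ _ _ m)/=; [|lia..].
rewrite (@big_ltn _ _ _ m); last lia.
rewrite am mulr0 add0r (sum_left_kinks _ xincr)//.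
by rewrite (sum_right_kinks _ xincr)//; ring.
Qed.

(** The hinges are convex, with a single kink of size [-1]: adding a multiple of
    a hinge changes one kink only. *)
Definition left_hinge x j i : R := if (i < j)%N then x j - x i else 0.
Definition right_hinge x j i : R := if (j < i)%N then x i - x j else 0.

Lemma kink_left_hinge N x j i : increasing_design N x ->
  (1 < i < N)%N -> kink x (left_hinge x j) i = - (i == j)%:R.
Proof.
move=> xincr iN; rewrite /kink /secant /left_hinge prednK; last lia.
have d1 : x i - x i.-1 != 0 by rewrite subr_eq0 gt_eqF// xincr//; lia.
have d2 : x i.+1 - x i != 0 by rewrite subr_eq0 gt_eqF// xincr//; lia.
have [<-|ne] := eqVneq i j.
  by rewrite ltnn leqnn ltnNge leqnSn/=; field; rewrite ?d1 ?d2.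
rewrite mulr0n oppr0; have [ij|ij] := ltnP i j.
  rewrite (ltnW ij); have [ij'|ij'] := ltnP i.+1 j; first by field; rewrite ?d1 ?d2.
  have -> : j = i.+1 by lia.
  by field; rewrite ?d1 ?d2.
have -> : (i <= j)%N = false by lia.
have -> : (i.+1 < j)%N = false by lia.
by rewrite subrr !mul0r subrr.
Qed.

Lemma kink_right_hinge N x j i : increasing_design N x ->
  (1 < i < N)%N -> kink x (right_hinge x j) i = - (i == j)%:R.
Proof.
move=> xincr iN; rewrite /kink /secant /right_hinge prednK; last lia.
have d1 : x i - x i.-1 != 0 by rewrite subr_eq0 gt_eqF// xincr//; lia.
have d2 : x i.+1 - x i != 0 by rewrite subr_eq0 gt_eqF// xincr//; lia.
have [<-|ne] := eqVneq i j.
  rewrite ltnn ltnS leqnn /=.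
  have -> : (i < i.-1)%N = false by lia.
  by field; rewrite ?d1 ?d2.
rewrite mulr0n oppr0; have [ij|ij] := ltnP j i.
  have -> : (j < i.+1)%N by lia.
  have [ij'|ij'] := ltnP j i.-1; first by field; rewrite ?d1 ?d2.
  have -> : j = i.-1 by lia.
  by field; rewrite ?d1 ?d2.
have -> : (j < i.-1)%N = false by lia.
have -> : (j < i.+1)%N = false by lia.
by rewrite subrr !mul0r subrr.
Qed.

Lemma pairing_left_hinge N x d j : (1 <= j <= N)%N ->
  \sum_(1 <= i < N.+1) d i * left_hinge x j i = left_moment x d j.
Proof.
move=> jN; rewrite (@big_cat_nat _ _ _ j)/=; [|lia..].
rewrite [X in _ + X]big_nat_eq0 => [|i /andP[ji _]]; last first.
  by rewrite /left_hinge ltnNge ji mulr0.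
rewrite addr0 left_momentE; last lia.
by apply: eq_big_nat => i /andP[_ ij]; rewrite /left_hinge ij.
Qed.

Lemma pairing_right_hinge N x d j : (1 <= j <= N)%N ->
  \sum_(1 <= i < N.+1) d i * right_hinge x j i = right_moment N x d j.
Proof.
move=> jN; rewrite (@big_cat_nat _ _ _ j.+1)/=; [|lia..].
rewrite big_nat_eq0 => [|i /andP[_ ij]]; last first.
  by rewrite /right_hinge ltnNge -ltnS ij mulr0.
rewrite add0r right_momentE; last lia.
by apply: eq_big_nat => i /andP[ji _]; rewrite /right_hinge ji.
Qed.

Lemma kinkD x a b j : kink x (fun i => a i + b i) j = kink x a j + kink x b j.
Proof. by rewrite /kink /secant; ring. Qed.

Lemma kinkZ x c a j : kink x (fun i => c * a i) j = c * kink x a j.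
Proof. by rewrite /kink /secant; ring. Qed.

Lemma kink_design N x i : increasing_design N x -> (1 < i < N)%N -> kink x x i = 0.
Proof.
move=> xincr iN; rewrite /kink /secant prednK; last lia.
rewrite !divff ?subrr//; rewrite subr_eq0 gt_eqF// xincr//; lia.
Qed.

Lemma eq_kink N x a b j : (1 < j < N)%N ->
  (forall i, (1 <= i <= N)%N -> a i = b i) -> kink x a j = kink x b j.
Proof. by move=> jN ab; rewrite /kink /secant !ab//; lia. Qed.

Definition concave_seq N x a : Prop :=
  forall j, (1 < j < N)%N -> 0 <= kink x a j.

End SummationByParts.

(** * Vectors of values of concave functions *)

Section ConcaveInterpolation.
Context (R : realType).
Implicit Types (x a : nat -> R).

Definition secant_line x a k (s : R) : R := a k + secant x a k * (s - x k).

(** The minimum of the secant lines through the points of index 1 to [p.+1],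
    prolonged to the whole line.  The recursion starts from one line, not from an
    empty minimum, so that the function is finite also for a single point. *)
Fixpoint polyline x a p (s : R) : R :=
  if p is q.+1 then Num.min (polyline x a q s) (secant_line x a q.+2 s)
  else secant_line x a 1 s.

Lemma increasing_design_neq N x k :
  increasing_design N x -> (1 <= k < N)%N -> x k.+1 != x k.
Proof. by move=> xincr kN; rewrite gt_eqF// xincr//; lia. Qed.

Lemma polyline_le_last x a p s : polyline x a p s <= secant_line x a p.+1 s.
Proof. by case: p => [|p] //=; rewrite ge_min lexx orbT. Qed.

Lemma secant_line_next x a k : x k.+1 != x k ->
  forall s, secant_line x a k s = a k.+1 + secant x a k * (s - x k.+1).
Proof.
move=> xk s; have dx : x k.+1 - x k != 0 by rewrite subr_eq0.
by rewrite /secant_line /secant; field.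
Qed.

Lemma secant_lineB N x a k s :
  increasing_design N x -> (1 <= k)%N -> (k.+1 < N)%N ->
  secant_line x a k.+1 s - secant_line x a k s = kink x a k.+1 * (x k.+1 - s).
Proof.
move=> xincr k1 kN; rewrite (@secant_line_next _ _ k); last first.
  by apply: increasing_design_neq xincr _; lia.
by rewrite /secant_line /kink /=; ring.
Qed.

(** Past its left endpoint, the last secant line is the lowest of all:
    consecutive secant lines cross at their common design point and the slopes
    decrease. *)
Lemma polyline_last N x a p s : increasing_design N x -> concave_seq N x a ->
  (p.+1 < N)%N \/ p = 0%N -> x p.+1 <= s ->
  polyline x a p s = secant_line x a p.+1 s.
Proof.
move=> xincr aconc; elim: p => [//|p IH] pN xs /=.
have xps : x p.+1 <= s by rewrite (le_trans _ xs)// ltW// xincr//; lia.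
rewrite IH//; last by lia.
apply/min_idPr; rewrite -subr_le0 (secant_lineB _ _ xincr)//; last lia.
by rewrite mulr_ge0_le0 ?aconc ?subr_le0//; lia.
Qed.

(** The bound [p.+2] is the right endpoint of the last secant line.  The case
    [p = 0] is allowed for every [N], which covers a design of one point. *)
Lemma polyline_interpolates N x a p i :
  increasing_design N x -> concave_seq N x a ->
  (p.+1 < N)%N \/ p = 0%N -> (1 <= i <= minn p.+2 N)%N ->
  polyline x a p (x i) = a i.
Proof.
move=> xincr aconc; elim: p => [|p IH] pN iN.
  have [iE|iE] : i = 1%N \/ i = 2%N by lia.
    by rewrite iE /= /secant_line subrr mulr0 addr0.
  rewrite iE /= secant_line_next ?subrr ?mulr0 ?addr0//.
  by apply: increasing_design_neq xincr _; lia.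
have [ip|ip] := leqP i p.+2; last first.
  have iE : i = p.+3 by lia.
  rewrite iE (polyline_last xincr aconc); [|lia|by rewrite ltW// xincr//; lia].
  rewrite secant_line_next ?subrr ?mulr0 ?addr0//.
  by apply: increasing_design_neq xincr _; lia.
rewrite /= IH; [|lia..]; apply/min_idPl.
rewrite -IH//; [|lia..].
apply: le_trans (polyline_le_last _ _ _ _) _.
rewrite -subr_ge0 (secant_lineB _ _ xincr)//; last lia.
rewrite mulr_ge0 ?aconc ?subr_ge0//; first lia.
have [->//|lt] : i = p.+2 \/ (i < p.+2)%N by lia.
by rewrite ltW// xincr//; lia.
Qed.

Lemma polyline_concave x a p (u v t : R) : 0 <= t <= 1 ->
  t * polyline x a p u + (1 - t) * polyline x a p v
  <= polyline x a p (t * u + (1 - t) * v).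
Proof.
move=> t01; have [t0 t1] : 0 <= t /\ 0 <= 1 - t by split; lra.
have line k : t * secant_line x a k u + (1 - t) * secant_line x a k v =
    secant_line x a k (t * u + (1 - t) * v) by rewrite /secant_line; ring.
elim: p => [|p IH] /=; first by rewrite line.
rewrite le_min -line; apply/andP; split.
  apply: le_trans IH; apply: lerD; apply: ler_wpM2l => //;
  by rewrite ge_min lexx.
by apply: lerD; apply: ler_wpM2l => //; rewrite ge_min lexx orbT.
Qed.

Lemma polyline_continuous x a p : continuous (polyline x a p : R -> R^o).
Proof.
have line k : continuous (secant_line x a k : R -> R^o).
  move=> s; apply: cvgD; first exact: cvg_cst.
  apply: cvgM; first exact: cvg_cst.
  by apply: cvgB; [exact: cvg_id | exact: cvg_cst].
elim: p => [|p IH] s /=; first exact: line.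
by apply: continuous_min; [exact: IH | exact: line].
Qed.

Lemma closed_proper_concave_EFin (f : R -> R) :
  continuous (f : R -> R^o) ->
  (forall u v t : R, 0 <= t <= 1 ->
     t * f u + (1 - t) * f v <= f (t * u + (1 - t) * v)) ->
  closed_proper_concave (fun s => (f s)%:E).
Proof.
move=> fcont fconc; split => [s||u v t t01|s b].
- exact: ltry.
- by exists 0; exact: ltNyr.
- by rewrite -!EFinM -EFinD lee_fin fconc.
rewrite lte_fin ltrNr => fb.
exists [set y | f y < - b].
  exact: (cvgr_lt (f s) (fcont s)) fb.
by move=> y /=; rewrite lte_fin ltrNr.
Qed.

Lemma econcave_kink N x (r : R -> \bar R) a j : increasing_design N x ->
  econcave r -> (forall i, (1 <= i <= N)%N -> r (x i) = (a i)%:E) ->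
  (1 < j < N)%N -> 0 <= kink x a j.
Proof.
move=> xincr rconc ra jN; rewrite /kink /secant prednK; last lia.
have xl : x j.-1 < x j by apply: xincr; lia.
have xr : x j < x j.+1 by apply: xincr; lia.
have D0 : 0 < x j.+1 - x j.-1 by lra.
pose t := (x j.+1 - x j) / (x j.+1 - x j.-1).
have t0 : 0 <= t by rewrite divr_ge0//; lra.
have t1 : t <= 1 by rewrite ler_pdivrMr//; lra.
have := rconc (x j.-1) (x j.+1) t; rewrite t0 t1 => /(_ isT).
have -> : t * x j.-1 + (1 - t) * x j.+1 = x j by rewrite /t; field; lra.
rewrite !ra; [|lia..]; rewrite -!EFinM -EFinD lee_fin => conc.
(* The drop of the slope at x_j is the gap between a_j and the chord over its
   two neighbours, up to a positive factor. *)
have -> : (a j - a j.-1) / (x j - x j.-1) - (a j.+1 - a j) / (x j.+1 - x j) =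
  (a j - (t * a j.-1 + (1 - t) * a j.+1)) *
  ((x j.+1 - x j.-1) / ((x j - x j.-1) * (x j.+1 - x j))).
  by rewrite /t; field; rewrite !subr_eq0 !gt_eqF//; lra.
by rewrite mulr_ge0 ?subr_ge0// divr_ge0 ?mulr_ge0//; lra.
Qed.

Lemma coord1_ord m (v : 'rV[R]_m) (j : 'I_m) : coord1 v j.+1 = v ord0 j.
Proof. by rewrite /coord1 /= valK. Qed.

Lemma coord1_row m a i : (1 <= i <= m)%N -> coord1 (\row_(j < m) a j.+1) i = a i.
Proof.
move=> im; have im' : (i.-1 < m)%N by lia.
have -> : i = (Ordinal im').+1 by rewrite /= prednK//; lia.
by rewrite coord1_ord mxE.
Qed.

(** Concavity of the extended function gives the kinks their sign; in the other
    direction the minimum of the secant lines is a finite continuous concave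
    function with the prescribed values. *)
Lemma anchored_vectorsP N x k0 (v : 'rV[R]_N) :
  increasing_design N x -> (1 <= k0 <= N)%N ->
  anchored_vectors x (x k0) v <->
  coord1 v k0 = 0 /\ concave_seq N x (coord1 v).
Proof.
move=> xincr k0N.
have coordP (r : R -> \bar R) : (forall j : 'I_N, r (x j.+1) = (v ord0 j)%:E) <->
    (forall i, (1 <= i <= N)%N -> r (x i) = (coord1 v i)%:E).
  split=> [rv i iN|rv j]; last by rewrite rv ?coord1_ord//= ltn_ord.
  have iN' : (i.-1 < N)%N by lia.
  have -> : i = (Ordinal iN').+1 by rewrite /= prednK//; lia.
  by rewrite coord1_ord rv.
split=> [[r [[_ _ rconc _] rk0] /coordP rv]|[vk0 vconc]].
  split; last by move=> j; exact: econcave_kink rv.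
  by have := rv _ k0N; rewrite rk0 => -[].
have interp i : (1 <= i <= N)%N -> polyline x (coord1 v) N.-2 (x i) = coord1 v i.
  by move=> iN; apply: (polyline_interpolates xincr vconc); lia.
pose r s : \bar R := (polyline x (coord1 v) N.-2 s)%:E.
exists r.
  split; last by rewrite /r interp// vk0.
  apply: closed_proper_concave_EFin; first exact: polyline_continuous.
  by move=> ? ? ?; exact: polyline_concave.
by apply/coordP => i iN; rewrite /r interp.
Qed.

End ConcaveInterpolation.

(** * The variational inequality in terms of moments *)

Section VariationalInequality.
Context (R : realType).
Implicit Types (x a d : nat -> R).

(** For one direction, [b] runs over [a + x], [a - x], [a] minus a hinge and, at a
    knot, [a] plus the hinge scaled by the kink of [a], which just flattens this
    kink.  The other direction is [pairing_kinks], for [b] and for [a]. *)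
Lemma variational_moments N x d a k0 :
  increasing_design N x -> (1 <= k0 <= N)%N -> x k0 = 0 ->
  a k0 = 0 -> concave_seq N x a ->
  (forall b, b k0 = 0 -> concave_seq N x b ->
     0 <= \sum_(1 <= i < N.+1) d i * (b i - a i)) <->
  [/\ forall j, (2 <= j <= k0)%N -> left_moment x d j <= 0 /\
        ((1 < j < N)%N -> kink x a j <> 0 -> left_moment x d j = 0),
      forall j, (k0.+1 <= j <= N.-1)%N -> right_moment N x d j <= 0 /\
        ((1 < j < N)%N -> kink x a j <> 0 -> right_moment N x d j = 0)
    & left_moment x d k0 = right_moment N x d k0].
Proof.
move=> xincr k0N xk0 ak0 aconc; split=> [vi|[leftP rightP balance]].
  have test g : g k0 = 0 -> concave_seq N x (fun i => a i + g i) ->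
      0 <= \sum_(1 <= i < N.+1) d i * g i.
    move=> gk0 agconc; have := vi _ _ agconc; rewrite ak0 gk0 addr0 => /(_ erefl).
    by under eq_bigr do rewrite addrC addKr.
  have testZ c g : g k0 = 0 ->
      (forall j, (1 < j < N)%N -> 0 <= kink x a j + c * kink x g j) ->
      0 <= c * \sum_(1 <= i < N.+1) d i * g i.
    move=> gk0 agconc; rewrite mulr_sumr.
    under eq_bigr do rewrite mulrCA.
    apply: test; first by rewrite gk0 mulr0.
    by move=> j jN; rewrite kinkD kinkZ agconc.
  have hinge g j : g k0 = 0 -> (1 < j <= N)%N ->
      (forall i, (1 < i < N)%N -> kink x g i = - (i == j)%:R) ->
      \sum_(1 <= i < N.+1) d i * g i <= 0 /\
      ((1 < j < N)%N -> kink x a j <> 0 -> \sum_(1 <= i < N.+1) d i * g i = 0).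
    move=> gk0 jN gkink; set s := \sum_(_ <= _ < _) _.
    have s0 : s <= 0.
      have := @testZ (-1) g gk0; rewrite -/s mulN1r oppr_ge0; apply.
      by move=> i iN; rewrite gkink// mulN1r opprK addr_ge0 ?aconc.
    split=> // jN' /eqP aj; apply/eqP; rewrite eq_le s0 /=.
    have aj0 : 0 < kink x a j by rewrite lt_def aj aconc.
    rewrite -(pmulr_rge0 _ aj0); apply: testZ => // i iN; rewrite gkink//.
    by have [->|_] := eqVneq i j; rewrite ?mulrN1 ?subrr// oppr0 mulr0 addr0 aconc.
  split=> [j jk0|j jk0|].
  - rewrite -(@pairing_left_hinge _ N); last lia.
    apply: hinge; [|lia|]; first by rewrite /left_hinge ltnNge; case/andP: jk0 => _ ->.
    by move=> i; exact: kink_left_hinge.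
  - rewrite -(@pairing_right_hinge _ N); last lia.
    apply: hinge; [|lia|]; first by rewrite /right_hinge ltnNge ltnW//; case/andP: jk0.
    by move=> i; exact: kink_right_hinge.
  - have sx : \sum_(1 <= i < N.+1) d i * x i = right_moment N x d k0 - left_moment x d k0.
      rewrite -(@pairing_left_hinge _ N)// -(@pairing_right_hinge _ N)// -sumrB.
      apply: eq_bigr => i _; rewrite -mulrBr; congr (_ * _).
      rewrite /left_hinge /right_hinge xk0.
      by case: (ltngtP i k0) => [_|_|->]; rewrite ?xk0 ?subr0 ?sub0r ?opprK ?oppr0 ?addr0 ?add0r.
    have le c : 0 <= c * (right_moment N x d k0 - left_moment x d k0).
      rewrite -sx; apply: testZ => // j jN.
      by rewrite (kink_design xincr)// mulr0 addr0 aconc.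
    by have := le 1; have := le (-1); lra.
(* The kink at the last design point is not constrained; it occurs in the
   expansion only when the anchor is that point, and its moment is then 0. *)
have leftN : k0 = N -> left_moment x d k0 = 0.
  by move=> k0E; rewrite balance k0E /right_moment big_geq.
have expand b : b k0 = 0 -> \sum_(1 <= i < N.+1) d i * b i =
   \sum_(2 <= j < k0.+1) - (left_moment x d j * kink x b j)
   + \sum_(k0.+1 <= j < N) - (right_moment N x d j * kink x b j).
  move=> bk0; rewrite (pairing_kinks d xincr k0N bk0) balance subrr mul0r.
  by rewrite !sumrN; ring.
move=> b bk0 bconc.
under eq_bigr do rewrite mulrBr.
rewrite sumrB [X in _ - X](_ : _ = 0).
  rewrite subr0 expand// addr_ge0// big_nat_cond sumr_ge0// => j /andP[jN _].
    have [jE|jlt] : j = N \/ (j < N)%N by lia.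
      have jk0 : j = k0 by lia.
      by rewrite jk0 leftN ?mul0r ?oppr0//; lia.
    have /leftP[L0 _] : (2 <= j <= k0)%N by lia.
    by rewrite oppr_ge0 mulr_le0_ge0 ?bconc//; lia.
  have /rightP[R0 _] : (k0.+1 <= j <= N.-1)%N by lia.
  by rewrite oppr_ge0 mulr_le0_ge0 ?bconc//; lia.
rewrite expand// !big_nat_eq0 ?addr0// => j jN; apply/eqP; rewrite oppr_eq0 mulf_eq0.
  have [//|/eqP aj] := eqVneq (kink x a j) 0; first by rewrite orbT.
  by rewrite (rightP j _).2 ?eqxx//; lia.
have [//|/eqP aj] := eqVneq (kink x a j) 0; first by rewrite orbT.
have [jE|jlt] : j = N \/ (j < N)%N by lia.
  have jk0 : j = k0 by lia.
  by rewrite jk0 leftN ?eqxx//; lia.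
by rewrite (leftP j _).2 ?eqxx//; lia.
Qed.

End VariationalInequality.

(** * Least squares over a convex set of vectors *)

Section LeastSquares.
Context (R : realType).

Lemma coord1_line m (v w : 'rV[R]_m) t i :
  coord1 (v + t *: (w - v)) i = coord1 v i + t * (coord1 w i - coord1 v i).
Proof.
by rewrite /coord1; case: insubP => [j _ _|_]; rewrite ?mxE//; ring.
Qed.

Lemma coord1_inj m (v w : 'rV[R]_m) :
  (forall i, (1 <= i <= m)%N -> coord1 v i = coord1 w i) -> v = w.
Proof.
move=> vw; apply/rowP => j; rewrite -!coord1_ord vw//=; exact: ltn_ord.
Qed.

(** [A] is the directional derivative and [B] the curvature of the quadratic along
    the segment. *)
Lemma slope_at_minimum (A B : R) : 0 <= B ->
  (forall t, 0 <= t <= 1 -> 0 <= t * A + 2^-1 * (t ^+ 2 * B)) -> 0 <= A.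
Proof.
move=> B0 quad; rewrite leNgt; apply/negP => A0.
have D0 : 0 < B - A by lra.
(* This step is at most 1 and lies before the positive root - 2 A / B of the
   quadratic (which is infinite for B = 0), where the value is still negative. *)
pose t := - A / (B - A).
have t0 : 0 < t by rewrite divr_gt0//; lra.
have t1 : t <= 1 by rewrite ler_pdivrMr//; lra.
have tB : t * B = - A + t * A by rewrite /t; field; lra.
have := quad t; rewrite (ltW t0) t1 => /(_ isT).
have -> : t * A + 2^-1 * (t ^+ 2 * B) = 2^-1 * t * (A + t * A).
  by rewrite expr2 -mulrA tB; field.
have At : A + t * A < 0 by nra.
by rewrite pmulr_rge0 ?mulr_gt0 ?invr_gt0//; lra.
Qed.

Context (N : nat) (k0 : nat) (obs : nat -> bool) (Y : nat -> R).
Context (obs_off : forall i, i != k0 -> obs i).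
Implicit Types v w : 'rV[R]_N.

(** The first-order term runs over all indices: the one that may be unobserved
    contributes 0. *)
Lemma least_squares_expansion v w : coord1 w k0 = coord1 v k0 ->
  least_squares obs Y w = least_squares obs Y v
  + \sum_(1 <= i < N.+1) (coord1 v i - Y i) * (coord1 w i - coord1 v i)
  + 2^-1 * \sum_(1 <= i < N.+1 | obs i) (coord1 w i - coord1 v i) ^+ 2.
Proof.
move=> wv; rewrite /least_squares !mulr_sumr.
rewrite !(big_mkcond obs)/= -!big_split/=; apply: eq_bigr => i _.
have [->|/obs_off ->] := eqVneq i k0; last by field.
by rewrite wv; case: (obs k0); field.
Qed.

(** Minimality gives the inequality by moving along segments in [C].  Conversely
    the expansion bounds the excess of [w] below by half the squared distance
    over the observed indices; the index [k0] is fixed on [C], so this distance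
    vanishes only for [w = v]. *)
Lemma unique_minimizer_variational (C : set 'rV[R]_N) v :
  (forall u w t, C u -> C w -> 0 <= t <= 1 -> C (u + t *: (w - u))) ->
  (forall u, C u -> coord1 u k0 = 0) -> C v ->
  unique_minimizer (least_squares obs Y) C v <->
  forall w, C w ->
    0 <= \sum_(1 <= i < N.+1) (coord1 v i - Y i) * (coord1 w i - coord1 v i).
Proof.
move=> Cconv C0 Cv; split=> [[_ vmin _] w Cw|vi].
  apply: (@slope_at_minimum _
    (\sum_(1 <= i < N.+1 | obs i) (coord1 w i - coord1 v i) ^+ 2)).
    by apply: sumr_ge0 => i _; exact: sqr_ge0.
  move=> t t01; have /vmin := Cconv _ _ _ Cv Cw t01.
  rewrite (@least_squares_expansion v (v + t *: (w - v))); last by rewrite !C0//; exact: Cconv.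
  rewrite -addrA lerDl.
  under eq_bigr do rewrite coord1_line addrAC subrr add0r mulrCA.
  under [X in _ + _ * X]eq_bigr do rewrite coord1_line addrAC subrr add0r exprMn.
  by rewrite -!mulr_sumr.
have minv w : C w -> least_squares obs Y v +
    2^-1 * \sum_(1 <= i < N.+1 | obs i) (coord1 w i - coord1 v i) ^+ 2
    <= least_squares obs Y w.
  move=> Cw; rewrite (@least_squares_expansion v w) ?C0//.
  by have := vi _ Cw; lra.
split=> // [w Cw|u Cu umin].
  apply: le_trans (minv _ Cw); rewrite lerDl mulr_ge0 ?invr_ge0//.
  by apply: sumr_ge0 => i _; exact: sqr_ge0.
have s0 : \sum_(1 <= i < N.+1 | obs i) (coord1 u i - coord1 v i) ^+ 2 <= 0.
  by have := minv _ Cu; have := umin _ Cv; lra.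
apply: coord1_inj => i iN; have [->|ik0] := eqVneq i k0; first by rewrite !C0.
apply/eqP; rewrite -subr_eq0 -sqrf_eq0 eq_le sqr_ge0 andbT.
apply: le_trans s0; rewrite big_mkcond (bigD1_seq i) ?iota_uniq//=; last first.
  by rewrite mem_index_iota.
rewrite obs_off// lerDl sumr_ge0// => j _.
by case: ifP => // _; exact: sqr_ge0.
Qed.

End LeastSquares.

(** * Characterization for an arbitrary increasing design *)

Section Characterization.
Context (R : realType).
Implicit Types (x a : nat -> R).

Lemma concave_seq_line N x a b t : 0 <= t <= 1 ->
  concave_seq N x a -> concave_seq N x b ->
  concave_seq N x (fun i => a i + t * (b i - a i)).
Proof.
move=> t01 aconc bconc j jN.
have -> : kink x (fun i => a i + t * (b i - a i)) j =
    (1 - t) * kink x a j + t * kink x b j by rewrite /kink /secant; ring.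
by rewrite addr_ge0// mulr_ge0 ?aconc ?bconc//; lra.
Qed.

Lemma knotP N x (f : R -> R) a j : (forall i, (1 <= i <= N)%N -> f (x i) = a i) ->
  knot N x f j <-> (1 < j < N)%N /\ kink x a j <> 0.
Proof.
move=> fa; rewrite /knot /chord_slope /kink /secant.
split=> -[jN]; rewrite !fa ?prednK; try lia; move=> ne; split=> //.
  by move/eqP; rewrite subr_eq0 => /eqP.
by move=> e; apply: ne; rewrite e subrr.
Qed.

Lemma unique_minimizer_moments N x k0 (obs : nat -> bool) (Y : nat -> R)
    (v : 'rV[R]_N) (f : R -> R) :
  let C := @anchored_vectors R N x (x k0) in
  let a := coord1 v in
  increasing_design N x -> (1 <= k0 <= N)%N -> x k0 = 0 ->
  (forall i, i != k0 -> obs i) -> C v ->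
  (forall i, (1 <= i <= N)%N -> f (x i) = a i) ->
  unique_minimizer (least_squares obs Y) C v <->
  [/\ forall j, (2 <= j <= k0)%N ->
        left_moment x a j <= left_moment x Y j /\
        (knot N x f j -> left_moment x a j = left_moment x Y j),
      forall j, (k0.+1 <= j <= N.-1)%N ->
        right_moment N x a j <= right_moment N x Y j /\
        (knot N x f j -> right_moment N x a j = right_moment N x Y j)
    & left_moment x a k0 - left_moment x Y k0
      = right_moment N x a k0 - right_moment N x Y k0].
Proof.
move=> C a xincr k0N xk0 obs_off Cv fa.
have CP w : C w <-> coord1 w k0 = 0 /\ concave_seq N x (coord1 w).
  exact: anchored_vectorsP.
have [ak0 aconc] := (CP v).1 Cv.
have Cline u w t : C u -> C w -> 0 <= t <= 1 -> C (u + t *: (w - u)).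
  move=> /CP[uk0 uconc] /CP[wk0 wconc] t01; apply/CP.
  rewrite (_ : coord1 (u + _) = fun i => coord1 u i + t * (coord1 w i - coord1 u i)).
    by split; [rewrite uk0 wk0; ring | exact: concave_seq_line].
  by apply/funext => i; exact: coord1_line.
apply: (iff_trans (@unique_minimizer_variational R N k0 obs Y obs_off C v Cline _ Cv)).
  by move=> u /CP[].
have := variational_moments (fun i => a i - Y i) xincr k0N xk0 ak0 aconc.
set seqVI := (X in X <-> _) => seqVIP.
apply: (@iff_trans _ seqVI).
  split=> [vi b bk0 bconc|vi w /CP[]]; last exact: vi.
  have bE i : (1 <= i <= N)%N -> coord1 (\row_(j < N) b j.+1) i = b i.
    exact: coord1_row.
  have /vi : C (\row_(j < N) b j.+1).
    apply/CP; split; first by rewrite bE.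
    by move=> j jN; rewrite (eq_kink _ jN bE) bconc.
  by under eq_big_nat => i iN do rewrite bE//.
apply: (iff_trans seqVIP).
split=> -[leftP rightP balance]; split=> [j jk|j jk|].
- have := leftP j jk; rewrite left_momentB subr_le0 => -[le0 eq0]; split=> //.
  by move=> /(knotP _ fa)[jN /(eq0 jN)/eqP]; rewrite subr_eq0 => /eqP.
- have := rightP j jk; rewrite right_momentB subr_le0 => -[le0 eq0]; split=> //.
  by move=> /(knotP _ fa)[jN /(eq0 jN)/eqP]; rewrite subr_eq0 => /eqP.
- by rewrite -left_momentB -right_momentB.
- have [le0 eq0] := leftP j jk; rewrite left_momentB subr_le0; split=> // jN aj.
  by rewrite eq0 ?subrr//; apply/(knotP _ fa).
- have [le0 eq0] := rightP j jk; rewrite right_momentB subr_le0; split=> // jN aj.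
  by rewrite eq0 ?subrr//; apply/(knotP _ fa).
- by rewrite left_momentB right_momentB.
Qed.

End Characterization.

(** * The augmented design *)

Section AugmentedDesign.
Context (R : realType) (n : nat) (xt : nat -> R) (x0 : R) (k0 : nat).
Context (anchor : is_anchor n xt x0 k0).

Lemma anchor_range : (1 <= k0 <= aug_size n xt x0)%N.
Proof.
by move: anchor; rewrite /is_anchor /aug_size; case: ifP => _ [].
Qed.

Lemma aug_points_anchor : aug_points n xt x0 k0 k0 = x0.
Proof.
by move: anchor; rewrite /is_anchor /aug_points ltnn eqxx; case: ifP => _ [].
Qed.

Lemma aug_points_increasing : increasing_design n xt ->
  increasing_design (aug_size n xt x0) (aug_points n xt x0 k0).
Proof.
move: anchor; rewrite /is_anchor /aug_size /aug_points /increasing_design.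
case: ifP => _ // [k0n left right] xtincr i j i1 ij jn.
have below l : (1 <= l < k0)%N -> xt l < x0.
  move=> lk; have := left ltac:(lia); apply: le_lt_trans.
  have [->//|lt] : l = k0.-1 \/ (l < k0.-1)%N by lia.
  by rewrite ltW// xtincr//; lia.
have above l : (k0 < l <= n.+1)%N -> x0 < xt l.-1.
  move=> lk; have := right ltac:(lia); move/lt_le_trans; apply.
  have [->//|lt] : l.-1 = k0 \/ (k0 < l.-1)%N by lia.
  by rewrite ltW// xtincr//; lia.
case: (ltngtP i k0) => ik; case: (ltngtP j k0) => jk; try lia.
- by apply: xtincr; lia.
- by apply: (lt_trans (below i _) (above j _)); lia.
- by apply: below; lia.
- by apply: xtincr; lia.
- by apply: above; lia.
Qed.

End AugmentedDesign.

Theorem theorem1 (R : realType) (d : measure_display) (T : measurableType d)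
    (P : probability T R) (n : nat) (xt : nat -> R)
    (eps : nat -> {RV P >-> R}) (Yt : nat -> T -> R) (rt0 : R -> R)
    (x0 y0 : R) (k0 : nat)
    (hxt : increasing_design n xt)
    (hconc : @convex_function R R^o setT (fun s => - rt0 s))
    (hdiff : derivable rt0 x0 1)
    (hy0 : rt0 x0 = y0)
    (hindep : mutually_independent n eps)
    (hident : identically_distributed n eps)
    (hmean : centered n eps)
    (hexp : exp_square_moment n eps)
    (hYt : forall i, (1 <= i <= n)%N -> forall w, Yt i w = rt0 (xt i) + eps i w)
    (hk0 : is_anchor n xt x0 k0)
    (hx0 : x0 = 0)
    (w : T) :
  let n0 := aug_size n xt x0 in
  let x := aug_points n xt x0 k0 in
  let Y := aug_responses n xt x0 k0 (fun i => Yt i w) y0 (derive1 rt0 x0) in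
  let C0n := @anchored_vectors R n0 x x0 in
  let phi := @least_squares R n0 (observed n xt x0 k0) Y in
  forall (rvec : 'rV[R]_n0) (rhat : R -> R),
  C0n rvec ->
  linear_interpolation n0 x (coord1 rvec) rhat ->
  let RL := sum_upto (coord1 rvec) in
  let SL := sum_upto Y in
  let RR := sum_from n0 (coord1 rvec) in
  let SR := sum_from n0 Y in
  unique_minimizer phi C0n rvec <->
  [/\ forall j, (2 <= j <= k0)%N ->
        \sum_(1 <= k < j) RL k * (x k.+1 - x k)
          <= \sum_(1 <= k < j) SL k * (x k.+1 - x k) /\
        (knot n0 x rhat j ->
         \sum_(1 <= k < j) RL k * (x k.+1 - x k)
           = \sum_(1 <= k < j) SL k * (x k.+1 - x k)),
      forall j, (k0.+1 <= j <= n0.-1)%N ->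
        \sum_(j.+1 <= k < n0.+1) RR k * (x k - x k.-1)
          <= \sum_(j.+1 <= k < n0.+1) SR k * (x k - x k.-1) /\
        (knot n0 x rhat j ->
         \sum_(j.+1 <= k < n0.+1) RR k * (x k - x k.-1)
           = \sum_(j.+1 <= k < n0.+1) SR k * (x k - x k.-1))
    & \sum_(1 <= k < k0) (RL k - SL k) * (x k.+1 - x k)
        = \sum_(k0.+1 <= k < n0.+1) (RR k - SR k) * (x k - x k.-1)].
Proof.
move=> n0 x Y C0n phi rvec rhat Crvec [rhatx _] RL SL RR SR.
have range : (1 <= k0 <= n0)%N := anchor_range hk0.
have xk0 : x k0 = x0 by exact: aug_points_anchor hk0.
have xincr : increasing_design n0 x := aug_points_increasing hk0 hxt.
have obs_off i : i != k0 -> observed n xt x0 k0 i.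
  by rewrite /observed => ->; rewrite orbT.
have Crvec' : anchored_vectors x (x k0) rvec by rewrite xk0.
have xk00 : x k0 = 0 by rewrite xk0.
have balanceE :
    (\sum_(1 <= k < k0) (RL k - SL k) * (x k.+1 - x k)
     = \sum_(k0.+1 <= k < n0.+1) (RR k - SR k) * (x k - x k.-1)) =
    (left_moment x (coord1 rvec) k0 - left_moment x Y k0
     = right_moment n0 x (coord1 rvec) k0 - right_moment n0 x Y k0).
  by rewrite -!sumrB; congr (_ = _); apply: eq_bigr => k _; rewrite mulrBl.
have := unique_minimizer_moments Y xincr range xk00 obs_off Crvec' rhatx.
by rewrite -/phi xk0 -balanceE; apply.
Qed.
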